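(* Three firefighters are necessary and sufficient to contain a fire on the infinite hexagonal grid $G_{\mathrm{hex}}$ in the distance-$1$ firefighter game; that is, $f_1(G_{\mathrm{hex}}) = 3$.
   Context: $G_{\mathrm{hex}}$ (the symbol's subscript denotes a hexagon) is the infinite hexagonal grid, i.e. the infinite $3$-regular graph of the tiling of the plane by regular hexagons; equivalently, up to isomorphism, the graph with vertex set $\mathbb{Z}\times\mathbb{Z}$ in which $(x,y)$ is adjacent to $(x\pm 1,y)$, and $(x,y)$ is adjacent to $(x,y+1)$ exactly when $x+y$ is odd. Distance-$d$ (distance-restricted) firefighter game on a graph $G$ with $k$ firefighters and fire at $u$: on turn $0$, the vertex $u$ starts burning, and then the $k$ firefighters are placed on unburnt vertices (several may occupy the same vertex), protecting the vertices they occupy. On each turn $t+1$ ($t\ge 0$), first the fire spreads to every unburnt, unprotected neighbour of every burning vertex; then each firefighter moves from its current vertex to an unburnt vertex at distance at most $d$ (possibly staying put, and several may occupy the same vertex), where the distance is measured in the subgraph of $G$ induced by the currently unburnt vertices (firefighters may not move through the fire), and protects the vertex it arrives at. Once a vertex is burning or protected it remains so for the rest of the game. The fire is contained if after finitely many turns a point is reached where the fire can no longer spread (no burning vertex has an unburnt, unprotected neighbour). $f_d(G,u)$ is the minimum $k$ for which a fire breaking out at $u$ can be contained; for a vertex-transitive graph $G$ this does not depend on $u$ and is written $f_d(G)$. *)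

(* Defs.v *)
From HB Require Import structures.
From mathcomp Require Import all_boot all_order all_algebra.
From mathcomp Require Import zify.

Set Implicit Arguments.
Unset Strict Implicit.
Unset Printing Implicit Defensive.

Record sgraph := SGraph {
  vertex :> eqType;
  adj : rel vertex;
  adj_sym : symmetric adj;
  adj_irrefl : irreflexive adj
}.

(* The distance between x and y in the subgraph of G induced by U is at most n:
   there is a walk x, s_1, ..., s_m = y in U with m <= n. *)
Definition dist_le_in (G : sgraph) (U : G -> Prop) (n : nat) (x y : G) : Prop :=
  exists s : seq G,
    [/\ path (@adj G) x s, last x s = y, size s <= n
      & forall z, z \in x :: s -> U z].

Section Game.

Variables (G : sgraph) (d k : nat) (u : G).

(* The fire does not make choices, so a play is determined by the positions of
   the firefighters: p t i is the position of firefighter i at the end of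
   turn t. *)
Variable p : nat -> 'I_k -> G.

Definition protected (t : nat) (v : G) : Prop :=
  exists s i, s <= t /\ p s i = v.

Fixpoint burning (t : nat) (v : G) : Prop :=
  if t is t'.+1 then
    burning t' v \/
    (exists w, burning t' w /\ adj w v) /\ ~ protected t' v
  else v = u.

(* Protected vertices count as unburnt. *)
Definition unburnt (t : nat) (v : G) : Prop := ~ burning t v.

(* The fire spreads before the firefighters move, so a move in turn t.+1 takes
   place among the vertices that are unburnt at turn t.+1. *)
Definition legal : Prop :=
  (forall i, unburnt 0 (p 0 i)) /\
  (forall t i, dist_le_in (unburnt t.+1) d (p t i) (p t.+1 i)).

Definition contained_at (t : nat) : Prop :=
  forall v w, burning t v -> adj v w -> burning t w \/ protected t w.

End Game.

Definition containable (G : sgraph) (d : nat) (u : G) (k : nat) : Prop :=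
  exists p : nat -> 'I_k -> G, legal d u p /\ exists t, contained_at u p t.

(* f_d(G, u) = k *)
Definition firefighter_number_at (G : sgraph) (d : nat) (u : G) (k : nat) :
  Prop :=
  containable d u k /\ forall k', containable d u k' -> k <= k'.

(* f_d(G) = k, that is, f_d(G, u) = k for every u *)
Definition firefighter_number (G : sgraph) (d k : nat) : Prop :=
  forall u : G, firefighter_number_at d u k.

(* The hexagonal grid as a brick wall: each edge is listed once, directed
   rightwards or upwards. *)
Definition hex_edge (a b : int * int) : bool :=
  (b == (a.1 + 1, a.2)%R) ||
  (b == (a.1, a.2 + 1)%R) && odd `|(a.1 + a.2)%R|%N.

Definition hex_adj (a b : int * int) : bool := hex_edge a b || hex_edge b a.

Lemma hex_adj_sym : symmetric hex_adj.
Proof. by move=> a b; rewrite /hex_adj orbC. Qed.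

Lemma hex_adj_irrefl : irreflexive hex_adj.
Proof.
move=> [x y]; rewrite /hex_adj orbb /hex_edge !xpair_eqE /=.
by apply/negbTE/negP; lia.
Qed.

Definition hex_grid : sgraph := SGraph hex_adj_sym hex_adj_irrefl.

(* Main.v *)
Require Import Defs.
From mathcomp Require Import all_boot.
From mathcomp Require Import all_order all_algebra zify.

(** Three firefighters win at once by occupying the three neighbours of [u].
    Conversely, let three rays leave [u] such that two points at distances [m]
    and [n] from [u] on different rays are at distance at least [max m n].
    The fire runs along each ray at unit speed until it meets a vertex
    protected in time, that is, before turn [n] if its distance to [u] is [n].
    If one firefighter protected such vertices on two rays, the one reached
    later at distance [n], then it walked a distance at least [n] in less than
    [n] turns. Hence every ray needs its own firefighter. *)

Set Implicit Arguments.
Unset Strict Implicit.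
Unset Printing Implicit Defensive.

(** * The game on an arbitrary graph *)

Section Game.

Variables (G : sgraph) (d k : nat) (u : G).

Lemma dist_le_in_trans (U : G -> Prop) m n x y z :
  dist_le_in U m x y -> dist_le_in U n y z -> dist_le_in U (m + n) x z.
Proof.
move=> [s [xs <- ms Us]] [s' [ys <- ns Us']]; exists (s ++ s'); split.
- by rewrite cat_path xs.
- by rewrite last_cat.
- by rewrite size_cat leq_add.
move=> v; rewrite -cat_cons mem_cat => /orP[/Us//|vs'].
by apply: Us'; rewrite inE vs' orbT.
Qed.

Lemma dist_le_in_sub (U V : G -> Prop) n x y :
  (forall v, U v -> V v) -> dist_le_in U n x y -> dist_le_in V n x y.
Proof. by move=> UV [s [? ? ? Us]]; exists s; split=> // v /Us/UV. Qed.

Lemma dist_le_in_refl (U : G -> Prop) n x : U x -> dist_le_in U n x x.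
Proof. by move=> Ux; exists [::]; split=> // v; rewrite inE => /eqP->. Qed.

Lemma dist_le_in_adj (U : G -> Prop) x y :
  U x -> U y -> adj x y -> dist_le_in U 1 x y.
Proof.
move=> Ux Uy xy; exists [:: y]; split=> //=; first by rewrite xy.
by move=> v; rewrite !inE => /orP[]/eqP->.
Qed.

Section Play.

Variable p : nat -> 'I_k -> G.

(** Only finitely many turns and firefighters have to be searched; this supplies the case split for
    the fire's progress along a ray. *)
Lemma protectedP t v : decidable (protected p t v).
Proof.
apply: (@decP _ [exists s : 'I_t.+1, exists i, p s i == v]).
apply: (iffP existsP) => [[s /existsP[i /eqP <-]]|[s [i [st <-]]]].
  by exists s, i; rewrite -ltnS.
by exists (Ordinal (st : s < t.+1)); apply/existsP; exists i.
Qed.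

Lemma burning_dist t v : burning u p t v -> dist_le_in (fun=> True) t u v.
Proof.
elim: t v => [v ->|t IHt v]; first exact: dist_le_in_refl.
case=> [/IHt [s [? ? st ?]]|[[w [/IHt uw wv]] _]].
  by exists s; split=> //; exact: leqW.
by rewrite -addn1; apply: (dist_le_in_trans uw); exact: dist_le_in_adj.
Qed.

Lemma protected_mono t t' v : t <= t' -> protected p t v -> protected p t' v.
Proof.
by move=> tt' [s [i [st <-]]]; exists s, i; split=> //; exact: leq_trans tt'.
Qed.

(** Protection persists, so the neighbours that stop the fire at turn [t] stop it at every later
    turn. *)
Lemma contained_burning t t' v :
  contained_at u p t -> burning u p (t + t') v -> burning u p t v.
Proof.
move=> ct; elim: t' v => [|t' IHt] v; first by rewrite addn0.
rewrite addnS => -[/IHt//|[[w [/IHt bw wv]] nprot]].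
by case: (ct _ _ bw wv) => // /(protected_mono (leq_addr t' t)).
Qed.

(** Forgetting the fire only relaxes the restriction on the moves, so distances in the whole graph
    bound what a firefighter can reach. *)
Lemma legal_dist s t i :
  legal 1 u p -> dist_le_in (fun=> True) t (p s i) (p (s + t) i).
Proof.
move=> [_ leg]; elim: t => [|t IHt]; first by rewrite addn0; exact: dist_le_in_refl.
rewrite addnS -[t.+1]addn1.
by apply: (dist_le_in_trans IHt); apply: dist_le_in_sub (leg _ i).
Qed.

Lemma ray_burning_or_protected (r : nat -> G) n :
  r 0 = u -> (forall m, adj (r m) (r m.+1)) ->
  burning u p n (r n) \/ exists m, protected p m (r m.+1).
Proof.
move=> r0 rS; elim: n => [|n [bn|]]; [by left| |by right].
(* The fire would enter [r n.+1] on turn [n.+1], before the firefighters move, so the protection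
   that counts is that of turn [n]. *)
case: (protectedP n (r n.+1)) => [prot|nprot]; first by right; exists n.
by left; right; split=> //; exists (r n).
Qed.

Lemma contained_ray_protected t (r : nat -> G) :
  contained_at u p t -> r 0 = u -> (forall m, adj (r m) (r m.+1)) ->
  (forall n l, dist_le_in (fun=> True) l u (r n) -> n <= l) ->
  exists m, protected p m (r m.+1).
Proof.
(* If [r t.+1] burnt at turn [t.+1], containment would make it burn at turn [t] already, although it
   is further than [t] from [u]. *)
move=> ct r0 rS geo; case: (ray_burning_or_protected t.+1 r0 rS) => // b.
by move: b; rewrite -addn1 => /(contained_burning ct)/burning_dist/geo; rewrite addn1 ltnn.
Qed.

End Play.

(** A bound by the position of the endpoint alone suffices, because the later of the two visits is
    always taken as the endpoint. *)
Lemma diverging_rays_bound m (r : 'I_m -> nat -> G) :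
  (forall i, r i 0 = u) -> (forall i n, adj (r i n) (r i n.+1)) ->
  (forall i n l, dist_le_in (fun=> True) l u (r i n) -> n <= l) ->
  (forall i j n n' l, i != j ->
     dist_le_in (fun=> True) l (r i n) (r j n') -> n' <= l) ->
  containable 1 u k -> m <= k.
Proof.
move=> r0 rS geo div [p [leg [t ct]]].
have /fin_all_exists[c cP] i : exists f, exists n s, s <= n /\ p s f = r i n.+1.
  have [n [s [f sf]]] := contained_ray_protected ct (r0 i) (rS i) (geo i).
  by exists f, n, s.
suff /leq_card : injective c by rewrite !card_ord.
move=> i j cij; apply/eqP/negPn/negP => ij.
(* Firefighter [f] has [s' - s <= n'] turns to walk a distance of at least [n'.+1]. *)
have ordered i' j' s s' n n' f : i' != j' -> s' <= n' -> s <= s' ->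
    p s f = r i' n.+1 -> p s' f = r j' n'.+1 -> False.
  move=> ij' sn' ss' ps ps'.
  have := legal_dist s (s' - s) f leg; rewrite subnKC // ps ps' => /(div _ _ _ _ _ ij').
  by move/leq_trans/(_ (leq_subr _ _))/leq_trans/(_ sn'); rewrite ltnn.
have [[n [s [sn ps]]] [n' [s' [sn' ps']]]] := (cP i, cP j); rewrite -cij in ps'.
have [ss'|/ltnW s's] := leqP s s'; first exact: ordered ij sn' ss' ps ps'.
by apply: ordered sn s's ps' ps; rewrite eq_sym.
Qed.

(** The firefighters stay on the neighbours of [u] forever, which is legal for every [d], and only
    [u] ever burns. *)
Lemma containable_neighbours (nb : 'I_k -> G) :
  (forall i, adj u (nb i)) -> (forall v, adj u v -> exists i, nb i = v) ->
  containable d u k.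
Proof.
move=> adj_nb nbP; pose p (_ : nat) i := nb i.
have prot t v : adj u v -> protected p t v by move=> /nbP[i <-]; exists 0, i.
have burningE t v : burning u p t v -> v = u.
  elim: t v => [//|t IHt] v [/IHt//|[[w [/IHt-> /(prot t)]]]] //.
have unburnt_nb t i : unburnt u p t (nb i).
  by move=> /burningE nbu; have := adj_nb i; rewrite nbu adj_irrefl.
exists p; split; first by split=> [i|t i]; [|apply: dist_le_in_refl]; exact: unburnt_nb.
by exists 0 => v w /burningE-> /(prot 0); right.
Qed.

(** Turns lower bounds on distances into integer arithmetic. *)
Lemma dist_le_in_lipschitz (f : G -> int) (U : G -> Prop) l v w :
  (forall x y, adj x y -> `|f x - f y| <= 1)%R ->
  dist_le_in U l v w -> (`|f v - f w| <= l%:Z)%R.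
Proof.
move=> lip [s [vs <- sl _]]; elim: s v l vs sl => [|x s IHs] v l /=; first by lia.
move=> /andP[/lip vx xs]; case: l => // l /(IHs _ _ xs); lia.
Qed.

End Game.

(** * Three diverging rays in the hexagonal grid *)

Section HexGrid.

Local Open Scope ring_scope.

Implicit Types u v : hex_grid.

(** The side on which the only vertical edge at [u] lies. *)
Definition hex_dir u : int := if odd `|(u.1 + u.2)%R|%N then 1 else -1.

Definition hex_neighbour u (i : 'I_3) : hex_grid :=
  match val i with
  | 0%N => (u.1 + 1, u.2)
  | 1%N => (u.1 - 1, u.2)
  | _ => (u.1, u.2 + hex_dir u)
  end.

(** The third ray is a staircase that alternates vertical and rightward steps, beginning with the
    vertical edge at [u]. A pair of steps preserves the parity of the coordinate sum, so all
    vertical steps go the same way. *)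
Definition hex_ray u (i : 'I_3) (n : nat) : hex_grid :=
  match val i with
  | 0%N => (u.1 + n%:Z, u.2)
  | 1%N => (u.1 - n%:Z, u.2)
  | _ => (u.1 + n./2%:Z, u.2 + hex_dir u * (uphalf n)%:Z)
  end.

Lemma hex_adjE u v :
  adj u v = [|| v == (u.1 + 1, u.2), v == (u.1 - 1, u.2)
              | v == (u.1, u.2 + hex_dir u)].
Proof.
case: u v => [x y] [x' y'].
rewrite /adj /= /hex_adj /hex_edge /hex_dir !xpair_eqE /=.
by apply/idP/idP; case: ifP; lia.
Qed.

Lemma hex_neighbour_adj u i : adj u (hex_neighbour u i).
Proof. by rewrite hex_adjE; case: i => -[|[|[|]]] //= ?; rewrite eqxx ?orbT. Qed.

Lemma hex_neighbour_surj u v : adj u v -> exists i, hex_neighbour u i = v.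
Proof.
rewrite hex_adjE => /or3P[]/eqP->.
- by exists (@Ordinal 3 0 isT).
- by exists (@Ordinal 3 1 isT).
- by exists (@Ordinal 3 2 isT).
Qed.

Lemma hex_ray0 u i : hex_ray u i 0 = u.
Proof. by case: u i => [x y] [[|[|i]] ?]; rewrite /hex_ray /=; congr pair; lia. Qed.

Lemma hex_ray_adj u i n : adj (hex_ray u i n) (hex_ray u i n.+1).
Proof.
case: u i => [x y] [[|[|i]] ?]; rewrite hex_adjE /hex_ray /hex_dir !xpair_eqE /=.
- by case: ifP; lia.
- by case: ifP; lia.
by case: ifP; case: ifP; lia.
Qed.

(* Measures the distance to the horizontal line through [u], two steps per
   row; the parity correction makes it change by one along every edge. *)
Definition hex_height u v : int :=
  2 * hex_dir u * (v.2 - u.2) - (odd `|(v.1 + v.2)%R| != odd `|(u.1 + u.2)%R|)%N%:Z.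

Lemma hex_height_lipschitz u v w : adj v w -> `|hex_height u v - hex_height u w| <= 1.
Proof.
rewrite hex_adjE /hex_height /hex_dir.
case: u v w => [x y] [x' y'] [x'' y'']; rewrite !xpair_eqE /=.
by case: ifP; case: ifP; lia.
Qed.

Lemma hex_dist_bounds U l u v w : dist_le_in U l v w ->
  [/\ `|v.1 - w.1| <= l%:Z,
      `|(v.1 - hex_dir u * v.2) - (w.1 - hex_dir u * w.2)| <= l%:Z
    & `|hex_height u v - hex_height u w| <= l%:Z].
Proof.
move=> vw; split.
- apply: (dist_le_in_lipschitz (f := fun x : hex_grid => x.1)) vw => -[x y] [x' y'].
  by rewrite hex_adjE !xpair_eqE /=; lia.
- apply: (dist_le_in_lipschitz
    (f := fun x : hex_grid => x.1 - hex_dir u * x.2)) vw => -[x y] [x' y'].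
  by rewrite hex_adjE /hex_dir !xpair_eqE /=; do 2 case: ifP; lia.
exact: dist_le_in_lipschitz (@hex_height_lipschitz u) vw.
Qed.

(** The first coordinate separates the two horizontal rays, and the left ray from the staircase when
    the endpoint is on the left ray. On the staircase [v.1 - hex_dir u * v.2] stays within one below
    its value at [u], while on the right ray it grows by one per step. An endpoint on the staircase
    has height exactly [n'], and horizontal rays have height 0 or -1. *)
Lemma hex_ray_diverge u i j n n' l : i != j ->
  dist_le_in (fun=> True) l (hex_ray u i n) (hex_ray u j n') -> (n' <= l)%N.
Proof.
move=> ij /(hex_dist_bounds u) [].
case: u i j ij => [x y] [[|[|[|i]]] ?] [[|[|[|j]]] ?] //= _;
  rewrite /hex_ray /hex_height /hex_dir /=; case: ifP; lia.
Qed.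

Lemma hex_ray_geodesic u i n l :
  dist_le_in (fun=> True) l u (hex_ray u i n) -> (n <= l)%N.
Proof.
(* The vertex [u] is also the start of a different ray, so divergence applies. *)
have [j ji] : exists j : 'I_3, j != i.
  by case: i => -[|i] ?; [exists (@Ordinal 3 1 isT)|exists (@Ordinal 3 0 isT)].
by rewrite -[X in dist_le_in _ _ X](hex_ray0 u j); exact: hex_ray_diverge.
Qed.

End HexGrid.

Theorem lemma5p1 : firefighter_number hex_grid 1 3.
Proof.
move=> u; split=> [|k].
  exact: (containable_neighbours (nb := hex_neighbour u) 1
    (hex_neighbour_adj u) (@hex_neighbour_surj u)).
exact: diverging_rays_bound (hex_ray0 u) (hex_ray_adj u)
  (@hex_ray_geodesic u) (@hex_ray_diverge u).
Qed.
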